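(* Let $G$ be a finitely generated group and let $A$ be a finite symmetric generating set for $G$. If $\mathrm{Cay}(G,A)$ contains an infinite contracting geodesic, then $G$ contains a contracting isometry (an element with a contracting axis in $\mathrm{Cay}(G,A)$). In particular, if $G$ is a torsion group, then $\mathrm{Cay}(G,A)$ does not contain an infinite contracting geodesic.
   Context: $\mathrm{Cay}(G,A)$ is the graph with vertex set $G$, with $g,h$ joined by an edge if $g^{-1}h\in A$, each edge having length $1$; $G$ acts on it by isometries by left multiplication. A geodesic is an isometric embedding of a closed interval of $\mathbb{R}$, identified with its image; it is infinite if the interval is unbounded. For a closed subset $C$ of a proper geodesic metric space $X$ and $x\in X$, $\pi_C(x)=\{p\in C : d(x,p)=\min_{y\in C} d(x,y)\}$, and $\pi_C(B)=\bigcup_{x\in B}\pi_C(x)$ for $B\subseteq X$. A geodesic $\alpha$ is $D$-contracting if for every closed metric ball $B$ disjoint from $\alpha$, $\operatorname{diam}(\pi_\alpha(B))\le D$; it is contracting if it is $D$-contracting for some $D$. An element $g\in G$ is a contracting isometry if it has a contracting axis in $\mathrm{Cay}(G,A)$: a bi-infinite contracting geodesic that is invariant under the left action of $g$ and on which $g$ acts as a nontrivial translation. *)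

(* Defs.v *)
From HB Require Import structures.
From mathcomp Require Import all_boot all_order all_algebra.
From mathcomp Require Import finmap.
From mathcomp Require Import all_classical all_reals all_analysis.
From mathcomp Require Import lra.

Set Implicit Arguments.
Unset Strict Implicit.
Unset Printing Implicit Defensive.

Import Order.TTheory GRing.Theory Num.Theory.
Import numFieldNormedType.Exports.

Local Open Scope classical_set_scope.
Local Open Scope ring_scope.

Section ContractingGeodesics.
Context {R : realType} {X : metricType R}.

(* The library's [closed_ball] is the closure of the open ball, which in
   general is smaller than this set. *)
Definition closed_mball (x : X) (r : R) : set X := [set y | mdist x y <= r].

Definition closest_points (C : set X) (x : X) : set X :=
  [set p | C p /\ forall y, C y -> mdist x p <= mdist x y].

Definition projection (C B : set X) : set X :=
  \bigcup_(x in B) closest_points C x.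

(* The extra 0 makes the diameter of the empty set 0 rather than -oo. *)
Definition diam (S : set X) : \bar R :=
  ereal_sup (0%E |` [set (mdist p q)%:E | p in S & q in S]).

Definition D_contracting (D : R) (alpha : set X) : Prop :=
  forall (x : X) (r : R), closed_mball x r `&` alpha = set0 ->
    (diam (projection alpha (closed_mball x r)) <= D%:E)%E.

Definition contracting (alpha : set X) : Prop :=
  exists D : R, D_contracting D alpha.

Definition closed_interval (I : set R) : Prop :=
  [/\ I !=set0, is_interval I & closed I].

(* The values of [gamma] outside [I] are irrelevant: the geodesic, as a
   subset of [X], is [gamma @` I]. *)
Definition geodesic (I : set R) (gamma : R -> X) : Prop :=
  closed_interval I /\
  forall s t, I s -> I t -> mdist (gamma s) (gamma t) = `|s - t|.

Definition has_infinite_contracting_geodesic : Prop :=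
  exists (I : set R) (gamma : R -> X),
    [/\ geodesic I gamma, ~ (has_lbound I /\ has_ubound I)
      & contracting (gamma @` I)].

End ContractingGeodesics.

Arguments has_infinite_contracting_geodesic {R} X.

Definition generates (G : groupType) (A : {fset G}) : Prop :=
  forall H : {pred G}, group_closed H -> {subset A <= H} ->
    forall g : G, g \in H.

Record symgenset (G : groupType) := SymGenSet {
  gens :> {fset G};
  gensV : forall a, a \in gens -> a^-1%g \in gens;
  gens_generates : generates gens
}.

Definition torsion (G : groupType) : Prop :=
  forall g : G, exists n : nat, (0 < n)%N /\ (g ^+ n = 1)%g.

(* [Cay(G, A)] is taken to be a simple graph: an identity element in [A]
   contributes no loops. *)
Definition adj (G : groupType) (A : symgenset G) : rel G :=
  [rel g h | (g != h) && ((g^-1 * h)%g \in gens A)].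

Definition walk (G : groupType) (A : symgenset G) (n : nat) (g h : G) : Prop :=
  exists s : seq G, [/\ path (adj A) g s, last g s = h & size s = n].

(* Points of the geometric realization are given by their barycentric
   coordinates: (1 - t) g + t h lies at distance t from g on the edge joining
   g to h, and the case g = h gives the vertices. *)
Definition cay_point (R : realType) (G : groupType) (A : symgenset G)
    (f : G -> R) : Prop :=
  exists (g h : G) (t : R), [/\ g = h \/ adj A g h, 0 <= t <= 1 &
    f = fun x => (1 - t) * (x == g)%:R + t * (x == h)%:R].

Record cay (R : realType) (G : groupType) (A : symgenset G) := Cay {
  bary :> G -> R;
  cayP : `[< cay_point A bary >]
}.

HB.instance Definition _ (R : realType) (G : groupType) (A : symgenset G) :=
  [isSub for @bary R G A].
HB.instance Definition _ (R : realType) (G : groupType) (A : symgenset G) :=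
  [Choice of cay R A by <:].

Section CayleyMetric.
Context {R : realType} {G : groupType} {A : symgenset G}.
Implicit Types (p q r : cay R A) (u v w x : G).

Lemma cay_pointP p : cay_point A p.
Proof. by case: p => f fP /=; apply/asboolP. Qed.

(* Lengths of the paths from p to q: either a segment of an edge {u, v}
   containing both, or a segment from p to an end point u of its edge, followed
   by an edge path of length n from u to v, and a segment from v to q.
   Note that 1 - p u is the distance from p to u inside its edge. *)
Definition on_edge p u v : Prop :=
  adj A u v /\ forall x, 0 < p x -> x = u \/ x = v.

Definition path_lengths p q : set R :=
  [set l | exists u v, [/\ on_edge p u v, on_edge q u v & l = `|p u - q u|]]
  `|`
  [set l | exists u v n, [/\ 0 < p u, 0 < q v, walk A n u v
                         & l = (1 - p u) + n%:R + (1 - q v)]].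

Definition cay_dist p q : R := inf (path_lengths p q).

Lemma adjC u v : adj A u v = adj A v u.
Proof.
have H a b : adj A a b -> adj A b a.
  rewrite /adj /= eq_sym => /andP[-> /gensV] /=.
  by rewrite invgM invgK.
by apply/idP/idP; apply: H.
Qed.

Lemma adjM g u v : adj A (g * u)%g (g * v)%g = adj A u v.
Proof. by rewrite /adj /= (inj_eq (mulgI g)) invgM divgKA. Qed.

Lemma walk0 u : walk A 0 u u.
Proof. by exists [::]. Qed.

Lemma walk1 u v : adj A u v -> walk A 1 u v.
Proof. by move=> uv; exists [:: v]; rewrite /= uv. Qed.

Lemma walkD m n u v w : walk A m u v -> walk A n v w -> walk A (m + n) u w.
Proof.
move=> [s [sp sl <-]] [t [tp tl <-]]; exists (s ++ t).
by rewrite cat_path sp sl tp last_cat sl tl size_cat.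
Qed.

Lemma walkC n u v : walk A n u v -> walk A n v u.
Proof.
move=> [s [sp sl <-]]; exists (rev (belast u s)); split.
- rewrite -sl rev_path; under eq_path => a b do rewrite adjC; exact: sp.
- by rewrite -sl; case: s {sp sl} => //= a s; rewrite rev_cons last_rcons.
- by rewrite size_rev size_belast.
Qed.

Lemma walkM g n u v : walk A n u v -> walk A n (g * u)%g (g * v)%g.
Proof.
move=> [s [sp sl <-]]; exists (map (fun x => g * x)%g s); split.
- rewrite path_map; under eq_path => a b do rewrite /relpre /= -/(adj A _ _).
  by rewrite (eq_path (e' := adj A)) // => a b; apply: adjM.
- by rewrite last_map sl.
- by rewrite size_map.
Qed.

Lemma walk_ex u v : exists n, walk A n u v.
Proof.
suff [n nP] : exists n, walk A n 1%g (u^-1 * v)%g.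
  by exists n; have := walkM u nP; rewrite mulg1 mulVKg.
pose H : {pred G} := [pred g | `[< exists n, walk A n 1%g g >]].
have HP g : reflect (exists n, walk A n 1%g g) (g \in H) by exact: asboolP.
apply/HP; apply: (gens_generates (s := A)); last first.
  move=> a aA; apply/HP; case: (eqVneq 1%g a) => [<-|a1].
    by exists 0; apply: walk0.
  by exists 1; apply: walk1; rewrite /adj /= a1 invg1 mul1g.
split; first by apply/HP; exists 0; apply: walk0.
move=> x y /HP[n xn] /HP[m ym]; apply/HP; exists (n + m)%N.
apply: (walkD xn); have := walkM (x * y^-1)%g (walkC ym).
by rewrite mulgVK mulg1.
Qed.

Variant cay_spec p : Prop :=
| CayVertex u of p u = 1 & (forall x, x <> u -> p x = 0)
| CayEdge u v of adj A u v & 0 < p u & 0 < p v & p u + p v = 1 &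
    (forall x, x <> u -> x <> v -> p x = 0).

Lemma cay_specP p : cay_spec p.
Proof.
have [u [v [t [uv /andP[t0 t1] pE]]]] := cay_pointP p.
have pxE x : p x = (1 - t) * (x == u)%:R + t * (x == v)%:R by rewrite pE.
case: (eqVneq u v) => [E|nuv].
  apply: (CayVertex (u := u)) => [|x /eqP xu]; rewrite pxE -E ?eqxx.
    by rewrite !mulr1 subrK.
  by rewrite (negbTE xu) !mulr0 addr0.
have {}uv : adj A u v by case: uv => // E; rewrite E eqxx in nuv.
have nvu : (v == u) = false by rewrite eq_sym (negbTE nuv).
have [E|tn0] := eqVneq t 0.
  apply: (CayVertex (u := u)) => [|x /eqP xu]; rewrite pxE E mul0r addr0 subr0 mul1r.
    by rewrite eqxx.
  by rewrite (negbTE xu).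
have [E|tn1] := eqVneq t 1.
  apply: (CayVertex (u := v)) => [|x /eqP xu]; rewrite pxE E subrr mul0r add0r mul1r.
    by rewrite eqxx.
  by rewrite (negbTE xu).
have t0' : 0 < t by rewrite lt_neqAle eq_sym tn0.
have t1' : t < 1 by rewrite lt_neqAle tn1.
have pu : p u = 1 - t by rewrite pxE eqxx (negbTE nuv) mulr0 mulr1 addr0.
have pv : p v = t by rewrite pxE eqxx nvu mulr0 mulr1 add0r.
apply: (CayEdge uv); rewrite ?pu ?pv; try lra.
by move=> x /eqP/negbTE xu /eqP/negbTE xv; rewrite pxE xu xv !mulr0 addr0.
Qed.

Lemma bary_ge0 p x : 0 <= p x.
Proof.
have [u [v [t [_ /andP[t0 t1] ->]]]] := cay_pointP p.
by rewrite addr_ge0 // mulr_ge0 ?ler0n ?subr_ge0.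
Qed.

Lemma bary_le1 p u : p u <= 1.
Proof.
case: (cay_specP p) => [w pw p0|w z _ w0 z0 wz p0].
  by have [->|/eqP/p0 ->] := eqVneq u w; lra.
have [->|/eqP uw] := eqVneq u w; first lra.
have [->|/eqP uz] := eqVneq u z; first lra.
by rewrite p0 //; lra.
Qed.

Lemma bary_le p u x : x <> u -> p x <= 1 - p u.
Proof.
move=> xu; have u1 := bary_le1 p u; have x1 := bary_le1 p x.
case: (cay_specP p) => [w pw p0|w z _ w0 z0 wz p0].
  have [xw|/eqP/p0 ->] := eqVneq x w; last lra.
  by rewrite (p0 u) ?subr0 // => uw; apply: xu; rewrite xw.
have [xw|/eqP xw] := eqVneq x w.
  have [->|/eqP uz] := eqVneq u z; first by rewrite xw; lra.
  by rewrite (p0 u) ?subr0 // => uw; apply: xu; rewrite xw.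
have [xz|/eqP xz] := eqVneq x z; last by rewrite p0 //; lra.
have [->|/eqP uw] := eqVneq u w; first by rewrite xz; lra.
by rewrite (p0 u) ?subr0 // => uz; apply: xu; rewrite xz.
Qed.

Lemma bary_pos p : exists u, 0 < p u.
Proof. by case: (cay_specP p) => [u pu _|u v _ pu _ _ _]; exists u; lra. Qed.

Lemma bary_eq0 p x : ~ 0 < p x -> p x = 0.
Proof. by move/negP; have := bary_ge0 p x; lra. Qed.

Lemma on_edgeC p u v : on_edge p u v -> on_edge p v u.
Proof. by case=> uv H; split; [rewrite adjC|move=> x /H []; tauto]. Qed.

Lemma on_edgeD p u v : on_edge p u v -> p u + p v = 1.
Proof.
case=> uv H; have nuv : u <> v by move=> E; move: uv; rewrite E /adj /= eqxx.
have p0 x : x <> u -> x <> v -> p x = 0.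
  by move=> xu xv; apply: bary_eq0 => /H [].
case: (cay_specP p) => [w pw w0|w z wz pw pz pwz _].
  have w1 : 0 < p w by rewrite pw.
  by case: (H w w1) => E; subst w; rewrite pw w0 ?addr0 ?add0r //; apply/nesym.
have nwz : w <> z by move=> E; move: wz; rewrite E /adj /= eqxx.
by have [Ew|Ew] := H w pw; have [Ez|Ez] := H z pz; subst; rewrite // addrC.
Qed.

Lemma on_edge_supp p u v a b : on_edge p u v -> a <> b -> 0 < p a -> 0 < p b ->
  (u = a /\ v = b) \/ (u = b /\ v = a).
Proof. by case=> _ H ab /H Ha /H Hb; case: Ha; case: Hb; intuition congruence. Qed.

Lemma edge_exit p q u v w : on_edge p u v -> on_edge q u v -> 0 < q w ->
  exists z n, [/\ 0 < p z, walk A n z w &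
    1 - p z + n%:R <= `|p u - q u| + (1 - q w)].
Proof.
move=> pE qE qw; wlog -> : u v pE qE / w = u => [H|].
  have [wu|wv] := proj2 qE w qw; first exact: (H u v).
  have -> : `|p u - q u| = `|p v - q v|.
    rewrite distrC; congr Num.norm.
    by have := on_edgeD pE; have := on_edgeD qE; lra.
  by apply: (H v u) => //; apply: on_edgeC.
have := on_edgeD pE; have := ler_norm (q u - p u); rewrite distrC => le1 pD.
have [pu|/negP/bary_eq0 pu] := boolP (0 < p u).
  by exists u, 0; split=> //; [exact: walk0|lra].
exists v, 1; split; [lra| |lra].
by apply: walk1; rewrite adjC; case: pE.
Qed.

Lemma path_lengthsC p q : path_lengths p q `<=` path_lengths q p.
Proof.
move=> _ [[u [v [pE qE ->]]]|[u [v [n [pu qv w ->]]]]].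
  by left; exists u, v; rewrite distrC.
by right; exists v, u, n; split=> //; [exact: walkC|lra].
Qed.

Lemma path_lengths_ge p q l x : path_lengths p q l -> `|p x - q x| <= l.
Proof.
have H0 r := bary_ge0 r x; have H1 r := bary_le1 r x; rewrite ler_norml.
case=> [[u [v [pE qE ->]]]|[u [v [[|n] [pu qv w ->]]]]].
- have := ler_norm (p u - q u); have := ler_norm (q u - p u).
  rewrite (distrC (q u)) => a b; have pD := on_edgeD pE; have qD := on_edgeD qE.
  have [->|/eqP xu] := eqVneq x u; first by apply/andP; split; lra.
  have [->|/eqP xv] := eqVneq x v; first by apply/andP; split; lra.
  have p0 r : on_edge r u v -> r x = 0 by case=> _ H; apply: bary_eq0 => /H [].
  by rewrite !p0 // subrr; apply/andP; split; have := normr_ge0 (p u - q u); lra.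
- case: w => [[|? ?] []//= _ uv _]; subst v.
  have := bary_le1 p u; have := bary_le1 q u; have := bary_ge0 p u.
  have := bary_ge0 q u; have [->|/eqP xu] := eqVneq x u.
    by move=> *; apply/andP; split; lra.
  have := bary_le p xu; have := bary_le q xu; have := H0 p; have := H0 q.
  by move=> *; apply/andP; split; lra.
- have := bary_le1 p u; have := bary_le1 q v; have := H0 p; have := H0 q.
  have := H1 p; have := H1 q; have := ler0n R n; rewrite -natr1.
  by move=> *; apply/andP; split; lra.
Qed.

Lemma path_lengths_neq0 p q : path_lengths p q !=set0.
Proof.
have [u pu] := bary_pos p; have [v qv] := bary_pos q; have [n w] := walk_ex u v.
by exists (1 - p u + n%:R + (1 - q v)); right; exists u, v, n.
Qed.

Lemma path_lengths_lb p q : lbound (path_lengths p q) 0.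
Proof.
have [x _] := bary_pos p => l /(path_lengths_ge x).
exact: le_trans.
Qed.

Lemma cay_dist_le p q l : path_lengths p q l -> cay_dist p q <= l.
Proof. by apply: ge_inf; exists 0; apply: path_lengths_lb. Qed.

Lemma le_cay_dist p q m :
  (forall l, path_lengths p q l -> m <= l) -> m <= cay_dist p q.
Proof. by move=> H; apply: lb_le_inf => //; apply: path_lengths_neq0. Qed.

Lemma path_lengthsD p q r l m : path_lengths p q l -> path_lengths q r m ->
  exists2 k, path_lengths p r k & k <= l + m.
Proof.
have EV p' q' r' u v a b n : on_edge p' u v -> on_edge q' u v -> 0 < q' a ->
    0 < r' b -> walk A n a b ->
    exists2 k, path_lengths p' r' k &
      k <= `|p' u - q' u| + ((1 - q' a) + n%:R + (1 - r' b)).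
  move=> pE qE qa rb w; have [z [k [pz wk le1]]] := edge_exit pE qE qa.
  exists (1 - p' z + (k + n)%:R + (1 - r' b)).
    by right; exists z, b, (k + n)%N; split=> //; apply: walkD wk w.
  by rewrite natrD; lra.
case=> [[u [v [pE qE ->]]]|[u [v [n [pu qv w ->]]]]]; last first.
  case=> [[u' [v' [qE rE ->]]]|[u' [v' [n' [qu' rv' w' ->]]]]].
    have [k kP kle] := EV _ _ _ _ _ _ _ _ rE qE qv pu (walkC w).
    exists k; first exact: path_lengthsC.
    by move: kle; rewrite distrC; lra.
  have [E|/eqP vu'] := eqVneq v u'.
    subst u'; exists (1 - p u + (n + n')%:R + (1 - r v')).
      by right; exists u, v', (n + n')%N; split=> //; apply: walkD w w'.
    by rewrite natrD; have := bary_le1 q v; lra.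
  exists (1 - p u + (n + 1 + n')%:R + (1 - r v')).
    right; exists u, v', (n + 1 + n')%N; split=> //; apply: walkD w'.
    apply: walkD w _; apply: walk1.
    case: (cay_specP q) => [a qa q0|a b ab qa qb qab q0].
      have S x : 0 < q x -> x = a.
        by move=> qx; apply/eqP/negPn/negP => /eqP/q0 E; rewrite E ltxx in qx.
      by case: vu'; rewrite (S _ qv) (S _ qu').
    have S x : 0 < q x -> x = a \/ x = b.
      move=> qx; have [->|/eqP xa] := eqVneq x a; first by left.
      have [->|/eqP xb] := eqVneq x b; first by right.
      by move: qx; rewrite q0 // ltxx.
    by case: (S v qv) => ?; case: (S u' qu') => ?; subst => //; rewrite adjC.
  by rewrite !natrD; have := bary_le q (nesym vu'); lra.
case=> [[u' [v' [qE' rE ->]]]|[u' [v' [n' [qu' rv' w' ->]]]]]; last first.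
  exact: (EV _ _ _ _ _ _ _ _ pE qE qu' rv' w').
case: (cay_specP q) => [a qa q0|a b ab qa qb qab q0].
  have qa0 : 0 < q a by lra.
  have [z [k [rz wk le1]]] := edge_exit rE qE' qa0.
  have [j jP jle] := EV p q r u v a z k pE qE qa0 rz (walkC wk).
  by exists j => //; move: le1 jle; rewrite qa (distrC (r u')); lra.
have nab : a <> b by move=> E; move: ab; rewrite E /adj /= eqxx.
have key s t : on_edge q s t -> forall p', on_edge p' s t ->
    on_edge p' a b /\ `|p' s - q s| = `|p' a - q a|.
  move=> qst p' pst; have [[sa tb]|[sb ta]] := on_edge_supp qst nab qa qb.
    by subst s t.
  subst s t; split; first exact: on_edgeC.
  by rewrite distrC; congr Num.norm; have := on_edgeD pst; lra.
have [pab ->] := key _ _ qE _ pE; have [rab re] := key _ _ qE' _ rE.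
exists `|p a - r a|; first by left; exists a, b.
by rewrite (distrC (q u')) re (distrC (r a)) ler_distD.
Qed.

Lemma cay_distxx p : cay_dist p p = 0.
Proof.
apply/eqP; rewrite eq_le le_cay_dist ?andbT; last exact: path_lengths_lb.
apply: cay_dist_le; case: (cay_specP p) => [u pu _|u v uv pu pv puv p0].
  right; exists u, u, 0; split; rewrite ?pu ?ltr01 //; first exact: walk0.
  by rewrite subrr !addr0.
left; exists u, v; rewrite subrr normr0; split=> //; split=> // x px.
all: have [->|/eqP xu] := eqVneq x u; first by left.
all: have [->|/eqP xv] := eqVneq x v; first by right.
all: by move: px; rewrite p0 // ltxx.
Qed.

Lemma cay_dist_eq0 p q : cay_dist p q = 0 -> p = q.
Proof.
move=> d0; apply: val_inj; apply/funext => x /=; apply/eqP.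
rewrite -subr_eq0 -normr_le0 -d0; apply: le_cay_dist => l.
exact: path_lengths_ge.
Qed.

Lemma cay_distC p q : cay_dist p q = cay_dist q p.
Proof.
by congr inf; rewrite eqEsubset; split; apply: path_lengthsC.
Qed.

Lemma cay_distD q p r : cay_dist p r <= cay_dist p q + cay_dist q r.
Proof.
rewrite -lerBlDr; apply: le_cay_dist => l lP.
rewrite lerBlDr addrC -lerBlDr; apply: le_cay_dist => m mP.
rewrite lerBlDr addrC; have [k kP kle] := path_lengthsD lP mP.
exact: le_trans (cay_dist_le kP) kle.
Qed.

End CayleyMetric.

HB.instance Definition _ (R : realType) (G : groupType) (A : symgenset G) :=
  isMetric.Build R (cay R A) cay_distxx cay_dist_eq0 cay_distC cay_distD.

Section CayleyAction.
Context {R : realType} {G : groupType} {A : symgenset G}.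

Lemma cay_act_subproof (g : G) (p : cay R A) :
  `[< cay_point A (fun x => p (g^-1 * x)%g) >].
Proof.
have [u [v [t [uv t01 pE]]]] := cay_pointP p; apply/asboolP.
exists (g * u)%g, (g * v)%g, t; split=> //.
  by case: uv => [->|uv]; [left|right; rewrite adjM].
apply/funext => x; rewrite pE.
have E a : (g^-1 * x == a)%g = (x == g * a)%g.
  by apply/eqP/eqP => [<-|->]; rewrite ?mulVKg ?mulKg.
by rewrite !E.
Qed.

Definition cay_act (g : G) (p : cay R A) : cay R A :=
  Cay (cay_act_subproof g p).

Definition contracting_axis (g : G) (gamma : R -> cay R A) : Prop :=
  [/\ geodesic setT gamma,
      contracting (gamma @` setT),
      cay_act g @` (gamma @` setT) = gamma @` setT
    & exists2 tau : R, tau != 0 &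
        forall t, cay_act g (gamma t) = gamma (t + tau)].

End CayleyAction.

Definition contracting_isometry (R : realType) (G : groupType)
    (A : symgenset G) (g : G) : Prop :=
  exists gamma : R -> cay R A, contracting_axis g gamma.

(* Main.v *)
Require Import Defs.
From HB Require Import structures.
From mathcomp Require Import all_boot all_order all_algebra.
From mathcomp Require Import all_classical all_reals all_analysis.
From mathcomp Require Import finmap zify lra.

(* A contracting geodesic satisfies a strong form of contraction: if the
   projections of x and y are far apart, then d(x, y) is, up to a constant, the
   length of the detour through the two projections, and the same holds for
   every subsegment. In particular a geodesic from x to y passes near every
   point of the subsegment between the projections.

   Along an infinite contracting ray g_0, g_1, ..., record at g_n the function
   h |-> d(g_0, g_n h) - n on a large ball around 1. There are finitely many
   such functions, so two distant indices a < b have the same one. The geodesics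
   from t^-n g_0 to points near g_b, where t = g_b g_a^-1, pass near g_a, hence
   the recorded function is reproduced at t^n g_a for every n. Consequently the
   translates t^n [g_a, g_b] form a bi-infinite geodesic, on which t acts as a
   translation. This geodesic is contracting: if x and y project to points more
   than three periods apart, then a full translate of [g_a, g_b] lies between
   the projections, and strong contraction of that translate forces d(x, y) to
   exceed the distance from x to the axis. *)

Set Implicit Arguments.
Unset Strict Implicit.
Unset Printing Implicit Defensive.

Import Order.TTheory GRing.Theory Num.Theory.
Import numFieldNormedType.Exports.

Local Open Scope ring_scope.

(** * The word metric *)

Section WordMetric.
Context {G : groupType} (A : symgenset G).
Implicit Types x y z u v : G.

Lemma walk_exb x y : exists n, `[< walk A n x y >].
Proof. by have [n xy] := walk_ex (A := A) x y; exists n; apply/asboolP. Qed.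

Definition wdist x y : nat := ex_minn (walk_exb x y).

Lemma wdist_walk x y : walk A (wdist x y) x y.
Proof. by rewrite /wdist; case: ex_minnP => n /asboolP. Qed.

Lemma wdist_le n x y : walk A n x y -> (wdist x y <= n)%N.
Proof.
by move=> xy; rewrite /wdist; case: ex_minnP => m _; apply; apply/asboolP.
Qed.

Lemma wdistxx x : wdist x x = 0%N.
Proof. by apply/eqP; rewrite -leqn0; apply: wdist_le; apply: walk0. Qed.

Lemma wdist_eq0 x y : wdist x y = 0%N -> x = y.
Proof.
move=> xy0; have := wdist_walk x y; rewrite xy0.
by case=> s [_ <- /size0nil ->].
Qed.

Lemma wdistC x y : wdist x y = wdist y x.
Proof.
by apply/eqP; rewrite eqn_leq; apply/andP; split;
  apply/wdist_le/walkC/wdist_walk.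
Qed.

Lemma wdistD y x z : (wdist x z <= wdist x y + wdist y z)%N.
Proof. by apply: wdist_le; apply: walkD; apply: wdist_walk. Qed.

Lemma wdistM g x y : wdist (g * x)%g (g * y)%g = wdist x y.
Proof.
apply/eqP; rewrite eqn_leq; apply/andP; split; apply: wdist_le.
  exact/walkM/wdist_walk.
by have := walkM g^-1%g (wdist_walk (g * x)%g (g * y)%g); rewrite !mulKg.
Qed.

Lemma wdistMl g x y : wdist (g^-1 * x)%g y = wdist x (g * y)%g.
Proof. by rewrite -(wdistM g) mulVKg. Qed.

Lemma wdist1_adj x y : wdist x y = 1%N -> adj A x y.
Proof.
move=> xy1; have := wdist_walk x y; rewrite xy1.
by case=> -[|z [|w s]] []//= /andP[xz _] <-.
Qed.

Lemma wdist_adj x y : adj A x y -> wdist x y = 1%N.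
Proof.
move=> xy; have := wdist_le (walk1 xy); case E: (wdist x y) => [|[|n]] // _.
by move: xy; rewrite (wdist_eq0 E) /adj /= eqxx.
Qed.

Lemma wdist_between x y k : (k <= wdist x y)%N ->
  exists2 z, wdist x z = k & wdist z y = (wdist x y - k)%N.
Proof.
move=> kxy; have [s [sp sl ss]] := wdist_walk x y.
have xz : walk A k x (last x (take k s)).
  exists (take k s); split=> //; last by rewrite size_takel ?ss.
  by move: sp; rewrite -{1}(cat_take_drop k s) cat_path => /andP[].
have zy : walk A (wdist x y - k) (last x (take k s)) y.
  exists (drop k s); split; last by rewrite size_drop ss.
    by move: sp; rewrite -{1}(cat_take_drop k s) cat_path => /andP[].
  by rewrite -last_cat cat_take_drop.
exists (last x (take k s)); have := wdist_le xz; have := wdist_le zy;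
  have := wdistD (last x (take k s)) x y; lia.
Qed.

Fixpoint wball (k : nat) : seq G :=
  if k is k'.+1 then wball k' ++ [seq (a * h)%g | a <- gens A, h <- wball k']
  else [:: 1%g].

Lemma mem_wball k h : (wdist 1%g h <= k)%N -> h \in wball k.
Proof.
elim: k h => [|k IH] h /=.
  by rewrite leqn0 => /eqP/wdist_eq0 <-; rewrite inE.
rewrite mem_cat; have [hk _|hk hk1] := leqP (wdist 1%g h) k.
  by rewrite IH.
have E : wdist 1%g h = k.+1 by lia.
have [//|a a1 ah] := @wdist_between 1%g h 1; first by rewrite E.
have aA : a \in gens A.
  by have := wdist1_adj a1; rewrite /adj /= invg1 mul1g => /andP[].
apply/orP; right; apply/allpairsP; exists (a, (a^-1 * h)%g) => /=.
split=> //; last by rewrite mulVKg.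
by apply: IH; rewrite wdistC wdistMl mulg1 wdistC ah E; lia.
Qed.

End WordMetric.

(** * Strong contraction *)

Section Projections.
Context {G : groupType} {A : symgenset G}.
Notation d := (wdist A).
Implicit Types (x y z : G) (i j : int) (r s : nat).

(* [N x i r] says that, up to an error of [C], the point [g i] is closest to
   [x] on the geodesic [g] and lies at distance [r] from [x]. The index is an
   integer since [g] may be one half of a contracting geodesic which is
   infinite on both sides. *)
Record strongly_contracting (g : nat -> G) (C : nat)
    (N : G -> int -> nat -> Prop) : Prop := StronglyContracting {
  sc_geod : forall l m, d (g l) (g m) = `|l - m|%N;
  sc_ex : forall x, exists i r, N x i r;
  sc_le : forall x i r (l : nat), N x i r -> (d x (g l) <= r + `|i - l|)%N;
  sc_ge : forall x i r (l : nat), N x i r -> (r + `|i - l| <= d x (g l) + C)%N;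
  sc_dist : forall x y i j r s, N x i r -> N y j s ->
    (`|i - j| <= C)%N \/ (r + s + `|i - j| <= d x y + C)%N
}.

Section FromBalls.
(* [P x i] stands for: [g i] is within distance 1 of a closest point to [x] on
   the whole geodesic. The closest point itself need not be a vertex, whence
   the error terms 1 below. *)
Variables (J : int -> Prop) (g : int -> G) (P : G -> int -> Prop) (D : nat).
Hypothesis gJ : forall i j, J i -> J j -> d (g i) (g j) = `|i - j|%N.
Hypothesis PJ : forall x i, P x i -> J i.
Hypothesis Pex : forall x, exists i, P x i.
Hypothesis Pmin : forall x i j, P x i -> J j -> (d x (g i) <= d x (g j) + 1)%N.
Hypothesis Pball : forall x y i j, P x i -> P y j ->
  (d x y + 1 < d x (g i))%N -> (`|i - j| <= D)%N.

(** The balls around [x] and [y] that just miss [g] share a point [z] between them, and each moves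
    the projection by at most [D]. A centre within 1 of [g] lies in the ball around the other
    one. *)
Lemma disjoint_balls x y i j : P x i -> P y j ->
  (d x y + 4 <= d x (g i) + d y (g j))%N -> (`|i - j| <= 2 * D)%N.
Proof.
move=> xi yj xy.
have [x1|x1] := leqP (d x (g i)) 1.
  by have := Pball yj xi; rewrite wdistC; lia.
have [y1|y1] := leqP (d y (g j)) 1; first by have := Pball xi yj; lia.
have [|z xz zy] := @wdist_between G A x y (minn (d x (g i) - 2) (d x y)).
  exact: geq_minr.
have [k zk] := Pex z.
have := Pball xi zk; have := Pball yj zk; rewrite (wdistC A y z); lia.
Qed.

(* From [x], walk towards [y] by steps of about the distance to [g]. Each step
   moves the projection by at most [D], hence the walk wastes little length
   until it either comes close to [g] or gets near the projection of [y]. *)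
Lemma walk_to_geodesic n x y i j : (d x y <= n)%N -> P x i -> P y j ->
  [\/ (`|i - j| <= 2 * D)%N,
      (d x (g i) + d y (g j) + `|i - j| <= d x y + (3 * D + 3))%N
    | exists z k, [/\ P z k, (d x z + d z y)%N = d x y, (d z (g k) <= D + 3)%N
        & (d x (g i) + `|i - k| <= d x z + (D + 3))%N]].
Proof.
elim: n x i => [|n IH] x i xyn xi yj.
all: have [xK|xK] := leqP (d x (g i)) (D + 3);
  first by (constructor 3; exists x, i; split=> //; rewrite wdistxx; lia).
all: have [far|near] := leqP (d x y + 4) (d x (g i) + d y (g j));
  first by constructor 1; apply: (disjoint_balls xi yj).
  have := wdistD A y x (g j).
  have := Pmin xi (PJ yj); lia.
have [|z xz zy] := @wdist_between G A x y (d x (g i) - 3); first by lia.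
have [k zk] := Pex z.
have ik : (`|i - k| <= D)%N by apply: (Pball xi zk); lia.
have [zK|zK] := leqP (d z (g k)) (D + 3).
  by constructor 3; exists z, k; split=> //; lia.
have zyn : (d z y <= n)%N by lia.
(* In the last two cases, the shift [|i - k| <= D] and the 3 given up in choosing [z] are paid for
   by [D + 3 < d z (g k)]. *)
have [kj|le|[w [l [wl zwy wK le]]]] := IH z k zyn zk yj.
- by constructor 2; lia.
- by constructor 2; lia.
constructor 3; exists w, l.
have xzw := wdistD A z x w; have xwy := wdistD A w x y.
by split=> //; lia.
Qed.

(** Walking from [x] towards [y], then from [y] back towards the point [z] so found, yields [z] and
    [w] within [D + 3] of [g], where indices can be compared directly. Four errors of [D + 3] add
    up. *)
Lemma walk_both_sides x y i j : P x i -> P y j ->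
  (`|i - j| <= 2 * D)%N \/
  (d x (g i) + d y (g j) + `|i - j| <= d x y + (4 * D + 12))%N.
Proof.
move=> xi yj.
have [ij|le|[z [k [zk xzy zK lex]]]] := walk_to_geodesic (leqnn _) xi yj.
- by left.
- by right; lia.
have [jk|le|[w [l [wl yzw wK ley]]]] := walk_to_geodesic (leqnn _) yj zk.
- right; have := wdistD A z y (g k); have := Pmin yj (PJ zk).
  by rewrite (wdistC A y z); lia.
- by right; move: le; rewrite (wdistC A y z); lia.
right; have := gJ (PJ zk) (PJ wl).
have := wdistD A z (g k) (g l); have := wdistD A w z (g l).
move: yzw ley; rewrite (wdistC A y z) (wdistC A (g k) z) (wdistC A w z); lia.
Qed.

Lemma strongly_contracting_of_balls : (forall n : nat, J n) ->
  strongly_contracting (fun n => g n) (4 * D + 14)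
    (fun x i r => P x i /\ r = d x (g i)).
Proof.
move=> Jn; split.
- by move=> l m; apply: gJ.
- by move=> x; have [i xi] := Pex x; exists i, (d x (g i)).
- move=> x i r l [xi ->]; rewrite -gJ //; [exact: wdistD|exact: PJ xi].
(* By [Pmin], the index [k] chosen for the vertex [g l] is within 1 of [l]. *)
- move=> x i r l [xi ->]; have [k lk] := Pex (g l).
  have := Pmin lk (Jn l); rewrite wdistxx gJ //; last exact: PJ lk.
  by have := Pmin xi (Jn l); case: (walk_both_sides xi lk); lia.
move=> x y i j r s [xi ->] [yj ->].
by have [] := walk_both_sides xi yj; [left|right]; lia.
Qed.

End FromBalls.
End Projections.

(** * Pumping *)

Section Pumping.
Context {G : groupType} {A : symgenset G}.
Notation d := (wdist A).
Variables (g : nat -> G) (C : nat) (N : G -> int -> nat -> Prop).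
Hypothesis gN : strongly_contracting (A := A) g C N.
Implicit Types (x y z h : G) (i j : int) (a b n : nat).

(** Comparing [z] with [g a] and [g b] gives [|i - a| + (b - a) <= |i - b| + C], which fails once
    [i] passes [a + C]. *)
Lemma index_le_start z i r a b : N z i r -> (a + C < b)%N ->
  d z (g b) = (d z (g a) + (b - a))%N -> i <= (a + C)%:Z.
Proof.
move=> zi ab zab; have := sc_le gN b zi; have := sc_ge gN a zi; lia.
Qed.

Lemma index_ge_end z i r a b : N z i r -> (a + C < b)%N ->
  d z (g a) = (d z (g b) + (b - a))%N -> b%:Z - C%:Z <= i.
Proof.
move=> zi ab zab; have := sc_le gN a zi; have := sc_ge gN b zi; lia.
Qed.

(** [z] projects before [a + C] and [x] beyond [a + 7 * C], so [d z x] is, up to [C], the length of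
    the detour along [g]. The point at distance [d z (g a)] from [z] is therefore near [g a]. *)
Lemma geodesic_passes_near z x j s a b : (a + C < b)%N ->
  d z (g b) = (d z (g a) + (b - a))%N ->
  N x j s -> (a + 7 * C)%:Z < j ->
  exists2 y, (d z y + d y x)%N = d z x & (d y (g a) <= 7 * C)%N.
Proof.
move=> ab zab xj aj; have [i [r zi]] := sc_ex gN z.
have ia := index_le_start zi ab zab.
have za := sc_le gN a zi; have xa := sc_le gN a xj.
have [|zx] := sc_dist gN zi xj; first by lia.
have [|y zy yx] := @wdist_between G A z x (d z (g a)); first by lia.
exists y; first lia.
have [l [q yl]] := sc_ex gN y; have ya := sc_le gN a yl.
have zax := wdistD A (g a) z x; rewrite (wdistC A (g a) x) in zax.
by have := sc_dist gN zi yl; have := sc_dist gN yl xj; lia.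
Qed.

(** The ball covers the error [7 * C] above; the extra 1 gives [C < K] even if [C = 0], so that
    [g (a + K)], at distance exactly [K] from [g a], can be the second point in
    [geodesic_passes_near]. *)
Let K := (7 * C + 1)%N.

Definition same_type a b := forall h, (d 1%g h <= K)%N ->
  d (g 0) (g b * h)%g = (d (g 0) (g a * h)%g + (b - a))%N.

Lemma same_type_ex (L : nat) : exists a b, (a + L < b)%N /\ same_type a b.
Proof.
pose B := wball A K; pose T := {ffun 'I_(size B) -> 'I_(2 * K).+1}.
(* Distinct multiples of [L.+1] differ by more than [L]. For [h] of length at most [K],
   [d (g 0) (g k * h)] is within [K] of [k], so neither the subtraction nor [inord] below
   truncates. *)
pose m k := (k * L.+1)%N.
pose ty (k : 'I_#|T|.+1) : T :=
  [ffun s : 'I_(size B) => inord (d (g 0) (g (m k) * nth 1%g B s)%g + K - m k)].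
have /injectivePn[k1 [k2 + tyE]] : ~~ injectiveb ty.
  apply/negP => /injectiveP/leq_card.
  by rewrite card_ord ltnn.
wlog k12 : k1 k2 tyE / (k1 < k2)%N.
  move=> H k12; case: (ltngtP k1 k2) => [lt|lt|/val_inj E].
  - exact: (H k1 k2).
  - by apply: (H k2 k1) => //; rewrite eq_sym.
  - by rewrite E eqxx in k12.
move=> _; exists (m k1), (m k2); have m12 : (m k1 + L < m k2)%N.
  by rewrite /m; nia.
split=> // h hK; have hB : h \in B by apply: mem_wball.
have := congr1 (fun f : T => val (f (Ordinal (etrans (index_mem h B) hB)))) tyE.
rewrite !ffunE /= !nth_index //.
have E k : (`|d (g 0) (g k * h)%g - k| <= K)%N.
  have := sc_geod gN 0 k; have := wdistD A (g k) (g 0) (g k * h)%g.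
  have := wdistD A (g k * h)%g (g 0) (g k).
  have := wdistM A (g k) 1%g h; rewrite mulg1 (wdistC A (g k * h)%g (g k)); lia.
have E1 := E (m k1); have E2 := E (m k2).
rewrite !inordK //; lia.
Qed.

(** The induction carries the whole recorded function at [g a], seen from [z n], and not only its
    value at 1, because geodesics are only known to pass near [g a]. *)
Lemma pumping (L : nat) : exists a b, (a + L < b)%N /\ forall n,
  d (g 0) ((g b * (g a)^-1) ^+ n * g a)%g = (a + n * (b - a))%N.
Proof.
(* The margin keeps the projection of [g b * h] beyond [a + 7 * C] for all [h] of length at most
   [K]. *)
have [a [b [ab abK]]] := same_type_ex (L + 3 * K + 2 * C).
exists a, b; split; first lia.
set t := (g b * (g a)^-1)%g; pose z n := (t ^- n * g 0)%g.
have step n : forall h, (d 1%g h <= K)%N ->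
    d (z n) (g a * h)%g = (d (g 0) (g a * h)%g + n * (b - a))%N.
  have aK : (a + C < a + K)%N by rewrite /K; lia.
  have z0a : d (g 0) (g (a + K)) = (d (g 0) (g a) + (a + K - a))%N.
    by rewrite !(sc_geod gN); lia.
  elim: n => [|n IH] h hK; first by rewrite /z expg0 invg1 mul1g; lia.
  have -> : d (z n.+1) (g a * h)%g = d (z n) (g b * h)%g.
    have -> : z n.+1 = (t^-1 * z n)%g by rewrite /z expgSr invgM mulgA.
    by rewrite wdistMl /t mulgA mulgVK.
  have near y : (d y (g a) <= 7 * C)%N ->
      d (z n) y = (d (g 0) y + n * (b - a))%N.
    move=> ya; rewrite -(mulVKg (g a) y); apply: IH.
    by rewrite wdistC wdistMl mulg1 /K; lia.
  have zna : d (z n) (g (a + K)) = (d (z n) (g a) + (a + K - a))%N.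
    rewrite (near (g a)) ?wdistxx // -(mulVKg (g a) (g (a + K))) IH.
      by rewrite mulVKg !(sc_geod gN); lia.
    by rewrite wdistC wdistMl mulg1 (sc_geod gN); lia.
  have [j [s xj]] := sc_ex gN (g b * h)%g.
  have bj := sc_ge gN b xj.
  have bh : d (g b * h)%g (g b) = d 1%g h.
    by rewrite wdistC -{1}(mulg1 (g b)) wdistM.
  have aj : (a + 7 * C)%:Z < j by rewrite /K in ab hK *; lia.
  (* Through [y], the distance from [z n] to [g b * h] is at least that from [g 0] plus
     [n * (b - a)]; through [y'] it is at most that. *)
  have [y zyx ya] := geodesic_passes_near aK zna xj aj.
  have [y' zyx' ya'] := geodesic_passes_near aK z0a xj aj.
  have := near y ya; have := near y' ya'; have := abK h hK.
  have := wdistD A y (g 0) (g b * h)%g; have := wdistD A y' (z n) (g b * h)%g.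
  rewrite mulSn; lia.
move=> n; have := step n 1%g; rewrite wdistxx mulg1 wdistMl => -> //.
by rewrite (sc_geod gN); lia.
Qed.

End Pumping.

(** * The axis and its contraction *)

Definition zpow (G : groupType) (t : G) (m : int) : G :=
  match m with Posz n => (t ^+ n)%g | Negz n => (t ^- n.+1)%g end.

Lemma zpowS (G : groupType) (t : G) m : zpow t (m + 1) = (t * zpow t m)%g.
Proof.
case: m => [n|[|n]].
- by rewrite -PoszD addn1 /= expgS.
- by rewrite /= expg1 mulgV.
have -> : Negz n.+1 + 1 = Negz n by lia.
by rewrite /= [in RHS]expgSr invgM mulVKg.
Qed.

Lemma zpowSr (G : groupType) (t : G) m : zpow t (m + 1) = (zpow t m * t)%g.
Proof.
case: m => [n|[|n]].
- by rewrite -PoszD addn1 /= expgSr.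
- by rewrite /= expg1 mulVg.
have -> : Negz n.+1 + 1 = Negz n by lia.
by rewrite /= [in RHS]expgS invgM mulgVK.
Qed.

Section Axis.
Context {G : groupType} {A : symgenset G}.
Notation d := (wdist A).
Variables (g : nat -> G) (C : nat) (N : G -> int -> nat -> Prop).
Hypothesis gN : strongly_contracting (A := A) g C N.
Variables a b : nat.
Let L := (b - a)%N.
Let t := (g b * (g a)^-1)%g.
Hypothesis abC : (a + (7 * C + 12) < b)%N.
Hypothesis gt : forall n, d (g 0) (t ^+ n * g a)%g = (a + n * L)%N.
Implicit Types (x y : G) (i j l m : int) (n k : nat).

Definition axis i : G := (zpow t (i %/ L%:Z)%Z * g (a + `|(i %% L%:Z)%Z|))%g.

Let L_gt0 : (0 < L)%N. Proof. by rewrite /L; lia. Qed.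
Let L_neq0 : L%:Z != 0. Proof. by have := L_gt0; lia. Qed.

(** The end [k = L] is allowed: consecutive translates share a vertex, as [t * g a = g b]. *)
Lemma axisE m k : (k <= L)%N ->
  axis (m * L%:Z + k%:Z) = (zpow t m * g (a + k))%g.
Proof.
rewrite leq_eqVlt => /predU1P[->|kL]; last first.
  by rewrite /axis divzMDl // modzMDl divz_small ?modz_small ?addr0 //; lia.
have -> : m * L%:Z + L%:Z = (m + 1) * L%:Z by rewrite mulrDl mul1r.
rewrite /axis mulzK // modzMl absz0 addn0 zpowSr -mulgA.
have -> : (a + L)%N = b by rewrite /L; lia.
by rewrite /t mulgVK.
Qed.

Lemma axis0 : axis 0 = g a.
Proof. by have := axisE 0 (leq0n L); rewrite mul0r addr0 addn0 mul1g. Qed.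

Lemma axis_decomp i : exists m k, (k < L)%N /\ i = m * L%:Z + k%:Z.
Proof.
exists (i %/ L%:Z)%Z, `|(i %% L%:Z)%Z|%N.
have := modz_ge0 i L_neq0; have := ltz_pmod i (d := L%:Z).
by have := divz_eq i L%:Z; have := L_gt0; lia.
Qed.

Lemma axisD i : axis (i + L%:Z) = (t * axis i)%g.
Proof.
have [m [k [kL ->]]] := axis_decomp i.
have -> : m * L%:Z + k%:Z + L%:Z = (m + 1) * L%:Z + k%:Z by lia.
by rewrite (axisE m (ltnW kL)) (axisE (m + 1) (ltnW kL)) zpowS mulgA.
Qed.

Lemma axis_le i j : (d (axis i) (axis j) <= `|i - j|)%N.
Proof.
have le1 l : (d (axis l) (axis (l + 1)) <= 1)%N.
  have [m [k [kL ->]]] := axis_decomp l.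
  have -> : m * L%:Z + k%:Z + 1 = m * L%:Z + k.+1%:Z by lia.
  by rewrite (axisE m kL) (axisE m (ltnW kL)) wdistM (sc_geod gN); lia.
have leD l n : (d (axis l) (axis (l + n%:Z)) <= n)%N.
  elim: n => [|n IH]; first by rewrite addr0 wdistxx.
  have := wdistD A (axis (l + n%:Z)) (axis l) (axis (l + n.+1%:Z)).
  have := le1 (l + n%:Z); have -> : l + n%:Z + 1 = l + n.+1%:Z by lia.
  lia.
wlog ij : i j / i <= j => [H|].
  have [|/ltW] := leP i j; first exact: H.
  by move=> /H; rewrite wdistC; lia.
have := leD i `|j - i|%N; have -> : i + `|j - i|%N%:Z = j by lia.
by lia.
Qed.

(** A 1-Lipschitz path whose ends are at full distance is geodesic in between. The ends at [-n * L]
    and [n * L] are so: translate by [t ^+ n] and compare with [gt] through [g 0]. *)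
Lemma axis_dist i j : d (axis i) (axis j) = `|i - j|%N.
Proof.
have far n : d (axis (- n%:Z * L%:Z)) (axis (n%:Z * L%:Z)) = (2 * n * L)%N.
  have shift k l : axis (l + k%:Z * L%:Z) = (t ^+ k * axis l)%g.
    elim: k => [|k IH]; first by rewrite mul0r addr0 mul1g.
    have -> : l + k.+1%:Z * L%:Z = l + k%:Z * L%:Z + L%:Z by lia.
    by rewrite axisD IH expgS mulgA.
  rewrite -(wdistM A (t ^+ n)) -!shift.
  have -> : - n%:Z * L%:Z + n%:Z * L%:Z = 0 by lia.
  have -> : n%:Z * L%:Z + n%:Z * L%:Z = 0 + (2 * n)%:Z * L%:Z by lia.
  rewrite shift axis0; have := gt (2 * n); have := sc_geod gN 0 a.
  have := wdistD A (g a) (g 0) (t ^+ (2 * n) * g a)%g.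
  have := axis_le 0 (0 + (2 * n)%:Z * L%:Z); rewrite shift axis0.
  by lia.
wlog ij : i j / i <= j => [H|].
  have [|/ltW] := leP i j; first by move=> ij; apply: H.
  by move=> ji; rewrite wdistC distnC; apply: H.
pose n := (`|i| + `|j|)%N; have {far} := far n.
have nL : (n <= n * L)%N by rewrite leq_pmulr.
have le1 := axis_le (- n%:Z * L%:Z); have le2 := axis_le ^~ (n%:Z * L%:Z).
have := wdistD A (axis i) (axis (- n%:Z * L%:Z)) (axis (n%:Z * L%:Z)).
have := wdistD A (axis j) (axis i) (axis (n%:Z * L%:Z)).
have := le1 i; have := le2 j; have := axis_le i j; rewrite /n in nL *; lia.
Qed.

(** [c] projects before [a + C]. If [x] projected much further, [g i], or [g b] when [i] is beyond
    [b], would by strong contraction be closer to [x] than [c] by more than 3. *)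
Lemma closest_before x c i r : N x i r ->
  d c (g b) = (d c (g a) + L)%N ->
  (forall k, (a <= k <= b)%N -> (d x c <= d x (g k) + 3)%N) ->
  i <= (a + (2 * C + 3))%:Z.
Proof.
move=> xi cab xc; have [j [s cj]] := sc_ex gN c.
have aCb : (a + C < b)%N by lia.
have ja := index_le_start gN cj aCb cab.
have [ij|le] := sc_dist gN xi cj; first lia.
have [ia|ia] := leP i a%:Z; first lia.
have [bi|ib] := leP b%:Z i.
  by have := xc b; have := sc_le gN b xi; lia.
by have := xc `|i|%N; have := sc_le gN `|i|%N xi; lia.
Qed.

Lemma closest_after x c i r : N x i r ->
  d c (g a) = (d c (g b) + L)%N ->
  (forall k, (a <= k <= b)%N -> (d x c <= d x (g k) + 3)%N) ->
  b%:Z - (2 * C + 3)%:Z <= i.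
Proof.
move=> xi cab xc; have [j [s cj]] := sc_ex gN c.
have aCb : (a + C < b)%N by lia.
have ja := index_ge_end gN cj aCb cab.
have [ij|le] := sc_dist gN xi cj; first lia.
have [ia|ia] := leP i a%:Z.
  by have := xc a; have := sc_le gN a xi; lia.
have [bi|ib] := leP b%:Z i; first lia.
by have := xc `|i|%N; have := sc_le gN `|i|%N xi; lia.
Qed.

Lemma axis_contracting x y i j :
  (forall l, (d x (axis i) <= d x (axis l) + 3)%N) ->
  (forall l, (d y (axis j) <= d y (axis l) + 3)%N) ->
  (forall l, (d x y < d x (axis l) + 3)%N) -> (`|i - j| <= 3 * L)%N.
Proof.
move=> xi yj xy; rewrite leqNgt; apply/negP => ij.
(* This translate starts after the smaller index and ends before the larger one; [u] carries it back
   to the segment from [g a] to [g b]. *)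
pose i0 := Num.min i j; pose m := (i0 %/ L%:Z)%Z + 1.
have [m0 m1] : i0 <= m * L%:Z /\ (m + 1) * L%:Z <= i0 + 2 * L%:Z.
  have := divz_eq i0 L%:Z; have := modz_ge0 i0 L_neq0.
  have : (i0 %% L%:Z)%Z < L%:Z by apply: ltz_pmod; have := L_gt0; lia.
  by rewrite /m !mulrDl mul1r; lia.
pose u : G := (zpow t m)^-1%g.
have uE z k : (a <= k <= b)%N ->
    d (u * z)%g (g k) = d z (axis (m * L%:Z + (k%:Z - a%:Z))).
  move=> akb; have -> : k%:Z - a%:Z = (k - a)%N by lia.
  by rewrite axisE ?wdistMl ?subnKC //; rewrite ?/L; lia.
have before z l e : l <= m * L%:Z ->
    (forall l', (d z (axis l) <= d z (axis l') + 3)%N) ->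
    forall r, N (u * z)%g e r -> e <= (a + (2 * C + 3))%:Z.
  move=> lm zl r ze; apply: (closest_before (c := (u * axis l)%g) ze).
    by rewrite !uE ?axis_dist ?leqnn; rewrite /L; lia.
  by move=> k kab; rewrite wdistM uE.
have after z l e : (m + 1) * L%:Z <= l ->
    (forall l', (d z (axis l) <= d z (axis l') + 3)%N) ->
    forall r, N (u * z)%g e r -> b%:Z - (2 * C + 3)%:Z <= e.
  move=> lm zl r ze; apply: (closest_after (c := (u * axis l)%g) ze).
    by rewrite !uE ?axis_dist ?leqnn; rewrite /L in lm *; lia.
  by move=> k kab; rewrite wdistM uE.
have [e [r xe]] := sc_ex gN (u * x)%g; have [f [s yf]] := sc_ex gN (u * y)%g.
have ab : (a <= b)%N by lia.
have := xy (m * L%:Z + (a%:Z - a%:Z)); have := xy (m * L%:Z + (b%:Z - a%:Z)).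
rewrite -!uE ?leqnn ?ab // -(wdistM A u x y).
have := sc_le gN a xe; have := sc_le gN b xe.
(* [e] and [f] are more than [3 * C + 6] apart, so [sc_dist] gives [d x y >= r + s + |e - f| - C].
   This exceeds the distance from [u * x] to the end of the segment on its side by at least 3; here
   the margin [7 * C + 12] is spent. *)
have [lt|le] := ltP i j.
  have im : i <= m * L%:Z by lia.
  have mj : (m + 1) * L%:Z <= j by lia.
  have := before x i e im xi r xe; have := after y j f mj yj s yf.
  by case: (sc_dist gN xe yf); case: (leP e a%:Z); lia.
have jm : j <= m * L%:Z by lia.
have mi : (m + 1) * L%:Z <= i by lia.
have := before y j f jm yj s yf; have := after x i e mi xi r xe.
by case: (sc_dist gN xe yf); case: (leP b%:Z e); lia.
Qed.

End Axis.

(** * Vertices and edges of the Cayley graph *)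

Section Vertices.
Context {R : realType} {G : groupType} {A : symgenset G}.
Implicit Types (p q : cay R A) (u v w : G).

Lemma mdist_cayE p q : mdist p q = cay_dist p q.
Proof. by []. Qed.

Lemma vert_subproof u : `[< cay_point (R := R) A (fun x => (x == u)%:R) >].
Proof.
apply/asboolP; exists u, u, 0; split; rewrite ?lexx ?ler01 //; first by left.
by apply/funext => x; rewrite subr0 mul1r mul0r addr0.
Qed.

Definition vert u : cay R A := Cay (vert_subproof u).

Lemma vertE u x : vert u x = (x == u)%:R.
Proof. by []. Qed.

Lemma eq_vert p u : p u = 1 -> p = vert u.
Proof.
move=> pu; apply: val_inj; apply/funext => x /=.
have [->//|/eqP xu] := eqVneq x u; apply/eqP; rewrite eq_le bary_ge0 andbT.
by have := bary_le p xu; rewrite pu subrr.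
Qed.

Lemma vert_gt0 u v : 0 < vert u v -> v = u.
Proof. by rewrite vertE; case: eqP; rewrite ?ltxx. Qed.

Lemma on_edge_mdist p q u v : on_edge p u v -> on_edge q u v ->
  mdist p q <= `|p u - q u|.
Proof. by move=> pe qe; apply: cay_dist_le; left; exists u, v. Qed.

Lemma mdist_vert_le p u : 0 < p u -> mdist p (vert u) <= 1 - p u.
Proof.
move=> pu; apply: cay_dist_le; right; exists u, u, 0; split=> //.
- by rewrite vertE eqxx.
- exact: walk0.
by rewrite vertE eqxx subrr !addr0.
Qed.

Lemma near_vert p : exists u, mdist p (vert u) <= 1.
Proof.
have [u pu] := bary_pos p; exists u.
by apply: le_trans (mdist_vert_le pu) _; lra.
Qed.

Lemma mdist_vert u v : mdist (vert u) (vert v) = (wdist A u v)%:R.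
Proof.
apply/eqP; rewrite eq_le; apply/andP; split.
  apply: cay_dist_le; right; exists u, v, (wdist A u v).
  split; rewrite ?vertE ?eqxx //; first exact: wdist_walk.
  by rewrite subrr addr0 add0r.
apply: le_cay_dist => l [[a [b [ue ve ->]]]|[a [b [n [ua vb w ->]]]]].
  have [->|uv] := eqVneq u v; first by rewrite wdistxx normr_ge0.
  have u1 : 0 < vert u u by rewrite vertE eqxx.
  have v1 : 0 < vert v v by rewrite vertE eqxx.
  have ab := proj1 ue.
  have [E1|E1] := proj2 ue u u1; have [E2|E2] := proj2 ve v v1; subst.
  - by rewrite eqxx in uv.
  - by rewrite (wdist_adj ab) !vertE eqxx (negbTE uv) subr0 normr1.
  - rewrite wdistC (wdist_adj ab) !vertE eqxx eq_sym (negbTE uv).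
    by rewrite sub0r normrN1.
  - by rewrite eqxx in uv.
move: (vert_gt0 ua) (vert_gt0 vb) => ? ?; subst.
by rewrite !vertE !eqxx subrr addr0 add0r ler_nat; apply: wdist_le.
Qed.

(** For [p] inside an edge, every path length from [vert u] is an integer plus some [1 - p c] with
    [p c > 0]. The gap [e] is uniform in the path, as the distance is an infimum. *)
Lemma vert_int_dist u p n : mdist (vert u) p = n%:R -> exists v, p = vert v.
Proof.
case: (cay_specP p) => [v pv _|v w vw pv pw pvw p0] up.
  by exists v; apply: eq_vert.
exfalso; pose e := Num.min (p v) (p w).
have e0 : 0 < e by rewrite lt_min pv.
suff : n%:R + e <= mdist (vert u) p by rewrite up; lra.
have frac (k : nat) c : 0 < p c -> n%:R <= k%:R + (1 - p c) ->
    n%:R + e <= k%:R + (1 - p c).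
  move=> pc nk; have ec : e <= 1 - p c.
    rewrite ge_min; have [->|/eqP cv] := eqVneq c v.
      by apply/orP; right; lra.
    have [->|/eqP cw] := eqVneq c w; first by apply/orP; left; lra.
    by move: pc; rewrite p0 // ltxx.
  suff : (n%:R : R) <= k%:R by lra.
  have [//|kn] := leqP n k; first by rewrite ler_nat.
  have : (k.+1%:R : R) <= n%:R by rewrite ler_nat.
  by rewrite -natr1; lra.
apply: le_cay_dist => l lP; have := cay_dist_le lP.
rewrite -mdist_cayE up.
case: lP => [[a [b [ue pe ->]]]|[a [c [k [ua pc _ ->]]]]].
  have u1 : 0 < vert u u by rewrite vertE eqxx.
  have pab := on_edgeD pe; have uab := on_edgeD ue.
  have [pv1 pw1] : p v < 1 /\ p w < 1 by split; lra.
  have pab1 c : p c < 1.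
    have [->//|/eqP cv] := eqVneq c v; have [->//|/eqP cw] := eqVneq c w.
    by rewrite p0 // ltr01.
  have pa1 := pab1 a; have pb1 := pab1 b.
  have [E|E] := proj2 ue u u1; subst.
    rewrite [X in `|X - _|]vertE eqxx /= ger0_norm; last lra.
    by rewrite -[1 - p a]add0r; move=> ?; apply: (frac 0%N); lra.
  have -> : vert b a = 0 by move: uab; rewrite (vertE b b) eqxx /=; lra.
  rewrite sub0r normrN ger0_norm; last lra.
  have -> : p a = 0%:R + (1 - p b) by lra.
  by move=> ?; apply: frac; lra.
have -> : vert u a = 1 by rewrite (vert_gt0 ua) vertE eqxx.
by rewrite subrr add0r; apply: frac.
Qed.

End Vertices.

(** * Geodesic lines in the Cayley graph through a sequence of vertices *)

Section Line.
Context {R : realType} {G : groupType} {A : symgenset G}.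
Variable alpha : int -> G.
Hypothesis alpha_dist : forall i j, wdist A (alpha i) (alpha j) = `|i - j|%N.
Implicit Types (m n : int) (s t : R).

Lemma alpha_adj m : adj A (alpha m) (alpha (m + 1)).
Proof. by apply: wdist1_adj; rewrite alpha_dist; lia. Qed.

Definition line_bary s (x : G) : R :=
  let m := Num.floor s in let t := s - m%:~R in
  (1 - t) * (x == alpha m)%:R + t * (x == alpha (m + 1))%:R.

Lemma line_subproof s : `[< cay_point A (line_bary s) >].
Proof.
apply/asboolP; exists (alpha (Num.floor s)), (alpha (Num.floor s + 1)).
exists (s - (Num.floor s)%:~R); split=> //; first by right; apply: alpha_adj.
have /andP[s0 s1] := floor_itv s; rewrite intrD in s1.
by apply/andP; split; lra.
Qed.

Definition line s : cay R A := Cay (line_subproof s).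

Lemma line_int m : line m%:~R = vert (alpha m).
Proof.
apply: eq_vert; rewrite /= /line_bary intrKfloor subrr subr0 eqxx.
by rewrite mul0r addr0 mulr1.
Qed.

(** The right end is included although the floor jumps there: the vertex [alpha (m + 1)] lies on
    both adjacent edges. *)
Lemma line_edge m s : m%:~R <= s <= (m + 1)%:~R ->
  on_edge (line s) (alpha m) (alpha (m + 1)) /\
  line s (alpha (m + 1)) = s - m%:~R.
Proof.
move=> /andP[ms]; rewrite le_eqVlt => /predU1P[->|sm].
  rewrite line_int vertE eqxx rmorphD /= addrAC subrr add0r; split=> //.
  by split; [exact: alpha_adj|move=> x /vert_gt0 ->; right].
have fm : Num.floor s = m by apply: floor_def; rewrite ms.
have ne : (alpha (m + 1) == alpha m) = false.
  by have := alpha_adj m; rewrite /adj /= eq_sym => /andP[/negbTE].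
split; last by rewrite /= /line_bary fm ne eqxx mulr0 mulr1 add0r.
split; first exact: alpha_adj.
move=> x; rewrite /= /line_bary fm.
have [->|xm] := eqVneq x (alpha m); first by left.
have [->|xm1] := eqVneq x (alpha (m + 1)); first by right.
by rewrite !mulr0 addr0 ltxx.
Qed.

Lemma line_near m s : m%:~R <= s <= (m + 1)%:~R ->
  mdist (line s) (line m%:~R) <= s - m%:~R /\
  mdist (line s) (line (m + 1)%:~R) <= (m + 1)%:~R - s.
Proof.
move=> sm; have [se sE] := line_edge sm; have /andP[ms sm1] := sm.
have m1 : (m%:~R : R) <= (m + 1)%:~R by rewrite ler_int; lia.
have [|me mE] := @line_edge m m%:~R; first by rewrite lexx.
have [|ne nE] := @line_edge m (m + 1)%:~R; first by rewrite lexx andbT.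
split; apply: le_trans (on_edge_mdist (on_edgeC _) (on_edgeC _)) _ => //.
all: try exact: se; try exact: me; try exact: ne.
  by rewrite sE mE ger0_norm; lra.
by rewrite sE nE ler0_norm; lra.
Qed.

Lemma line_int_dist m n : mdist (line m%:~R) (line n%:~R) = `|m - n|%:~R.
Proof. by rewrite !line_int mdist_vert alpha_dist -abszE. Qed.

Lemma line_le s t : s <= t -> mdist (line s) (line t) <= t - s.
Proof.
move=> st; pose m := Num.floor s; pose n := Num.floor t.
have mn : m <= n by apply: le_floor.
have sm : m%:~R <= s <= (m + 1)%:~R.
  by have /andP[-> /ltW] := floor_itv s.
have tn : n%:~R <= t <= (n + 1)%:~R.
  by have /andP[-> /ltW] := floor_itv t.
move: m n mn sm tn => m n mn sm tn.
have [E|mn'] := eqVneq m n.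
  rewrite -E in tn; have [se sE] := line_edge sm; have [te tE] := line_edge tn.
  apply: le_trans (on_edge_mdist (on_edgeC se) (on_edgeC te)) _.
  by rewrite sE tE ler0_norm; lra.
have [_ s1] := line_near sm; have [t1 _] := line_near tn.
have := metric_triangle (line s) (line (m + 1)%:~R) (line t).
have := metric_triangle (line (m + 1)%:~R) (line n%:~R) (line t).
rewrite line_int_dist (metric_sym (line n%:~R)) distrC ger0_norm; last first.
  by rewrite subr_ge0 lezD1 lt_neqAle mn'.
by rewrite intrB; lra.
Qed.

(** As for [axis_dist]: the line is 1-Lipschitz, and the distance between integer points far out on
    both sides is known. *)
Lemma line_dist s t : mdist (line s) (line t) = `|s - t|.
Proof.
wlog st : s t / s <= t => [H|].
  have [|/ltW] := leP s t; first exact: H.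
  by move=> /H; rewrite metric_sym distrC.
rewrite ler0_norm ?opprB; last lra.
apply/eqP; rewrite eq_le line_le //=.
have [n ns tn] : exists2 n : int, - n <= Num.floor s & Num.floor t + 1 <= n.
  move: (Num.floor s) (Num.floor t) => i j.
  by exists (`|i| + `|j| + 1)%N%:Z; lia.
have {}ns : (- n)%:~R <= s by apply: le_trans (floor_le s); rewrite ler_int.
have {}tn : t <= n%:~R.
  by apply: le_trans (ltW (floorD1_gt t)) _; rewrite ler_int.
have := metric_triangle (line (- n)%:~R) (line s) (line n%:~R).
have := metric_triangle (line s) (line t) (line n%:~R).
have := line_le ns; have := line_le tn; rewrite line_int_dist ler0_norm.
  by rewrite !(intrD, intrN); lra.
have : (- n)%:~R <= n%:~R :> R by lra.
by rewrite ler_int; lia.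
Qed.

Lemma line_act (g : G) (L : nat) :
  (forall i, alpha (i + L%:Z) = (g * alpha i)%g) ->
  forall s, cay_act g (line s) = line (s + L%:R).
Proof.
move=> gL s; apply: val_inj; apply/funext => x /=; rewrite /line_bary.
have -> : Num.floor (s + L%:R) = Num.floor s + L%:Z.
  by rewrite pmulrn floorDrz ?intrKfloor ?intr_int.
have E i : (g^-1 * x == alpha i)%g = (x == alpha (i + L%:Z))%g.
  by rewrite gL; apply/eqP/eqP => [<-|->]; rewrite ?mulVKg ?mulKg.
have -> : s + L%:R - (Num.floor s + L%:Z)%:~R = s - (Num.floor s)%:~R.
  by rewrite intrD pmulrn; lra.
by rewrite !E addrAC.
Qed.

End Line.

Local Open Scope classical_set_scope.

(** * Contraction of a line, deduced from its vertices *)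

Section LineContracting.
Context {R : realType} {G : groupType} {A : symgenset G}.
Notation d := (wdist A).
Variable alpha : int -> G.
Hypothesis alpha_dist : forall i j, d (alpha i) (alpha j) = `|i - j|%N.
Local Notation line := (line (R := R) alpha_dist).

(** Points are rounded to vertices within 1, and points of the line to their floor; three such
    errors account for the 3 in the hypothesis. Projections of the ball stay within [M + 1] of one
    index [i]. *)
Lemma line_contracting (M : nat) :
  (forall x y i j,
    (forall l, (d x (alpha i) <= d x (alpha l) + 3)%N) ->
    (forall l, (d y (alpha j) <= d y (alpha l) + 3)%N) ->
    (forall l, (d x y < d x (alpha l) + 3)%N) -> (`|i - j| <= M)%N) ->
  contracting (line @` setT).
Proof.
move=> alphaM; exists (2 * (M%:R + 1)) => x r xr.
have far s : r < mdist x (line s).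
  rewrite ltNge; apply/negP => xs; suff : set0 (line s) by [].
  by rewrite -xr; split=> //; exists s.
have [x' xx'] := near_vert x.
have [i xi] : exists i, forall l, (d x' (alpha i) <= d x' (alpha l))%N.
  have ex : exists n, `[< exists l, d x' (alpha l) = n >].
    by exists (d x' (alpha 0)); apply/asboolP; exists 0.
  case: (ex_minnP ex) => n /asboolP[i <-] imin; exists i => l.
  by apply: imin; apply/asboolP; exists l.
have near y p : closed_mball x r y -> closest_points (line @` setT) y p ->
    exists2 s, p = line s & `|s - i%:~R| <= M%:R + 1.
  move=> xy [[s _ <-] ys]; exists s => //.
  have [y' yy'] := near_vert y; pose j := Num.floor s.
  have /andP[js sj] := floor_itv s; rewrite intrD in sj.
  have vl u l : (d u (alpha l))%:R = mdist (vert u) (line l%:~R).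
    by rewrite line_int mdist_vert.
  have yl l : mdist y (line s) <= mdist y (line l%:~R).
    by apply: ys; exists l%:~R.
  have ij : (`|i - j| <= M)%N.
    apply: (alphaM x' y') => l; first by have := xi l; lia.
      rewrite -(ler_nat R) natrD !vl.
      have := metric_triangle (vert y') y (line j%:~R).
      have := metric_triangle y (line s) (line j%:~R).
      have := metric_triangle y (vert y') (line l%:~R).
      have := yl l; rewrite line_dist ger0_norm; last by rewrite /j; lra.
      by rewrite (metric_sym (vert y') y) /j; lra.
    rewrite -(ltr_nat R) natrD vl -mdist_vert.
    have := metric_triangle (vert x') x (vert y').
    have := metric_triangle x y (vert y').
    have := metric_triangle x (vert x') (line l%:~R).
    have := far l%:~R; rewrite (metric_sym (vert x') x).
    by move: xy; rewrite /closed_mball /=; lra.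
  have : `|(i - j)%:~R| <= M%:R :> R.
    by rewrite -intr_norm -abszE -pmulrn ler_nat.
  by rewrite intrB !ler_norml /j => /andP[? ?]; apply/andP; split; lra.
(* The first case is the extra 0 in [diam]. *)
apply: ge_ereal_sup => _ [->|[p [y xy yp] [q [z xz zq] <-]]].
  by rewrite lee_fin mulr_ge0 ?addr_ge0 ?ler0n.
have [s -> si] := near y p xy yp; have [t -> ti] := near z q xz zq.
rewrite lee_fin line_dist; move: si ti; rewrite !ler_norml.
by move=> /andP[? ?] /andP[? ?]; apply/andP; split; lra.
Qed.

End LineContracting.

Lemma strongly_contracting_isometry (R : realType) (G : groupType)
    (A : symgenset G) g C N : strongly_contracting (A := A) g C N ->
  exists h : G, contracting_isometry R A h.
Proof.
move=> gN; have [a [b [abC gt]]] := pumping gN (7 * C + 12).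
have alpha_dist := axis_dist gN abC gt.
have alphaD := axisD g abC.
exists (g b * (g a)^-1)%g, (line alpha_dist).
have act s := line_act alpha_dist alphaD s.
split.
- split; last by move=> s t _ _; apply: line_dist.
  by split; [exists 0|move=> ? ? ? ?|exact: closedT].
- exact/line_contracting/(axis_contracting gN abC gt).
- rewrite eqEsubset; split=> [_ [_ [s _ <-] <-]|_ [s _ <-]].
    by exists (s + (b - a)%:R); rewrite ?act.
  exists (line alpha_dist (s - (b - a)%:R)); first by exists (s - (b - a)%:R).
  by rewrite act subrK.
exists (b - a)%:R; last exact: act.
by rewrite pnatr_eq0; lia.
Qed.

(** * From contracting geodesics to strong contraction *)

Section Geodesics.
Context {R : realType} {X : metricType R}.
Implicit Types (I : set R) (gamma : R -> X).

Lemma mdist_lip (x y z : X) : `|mdist x y - mdist x z| <= mdist y z.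
Proof.
have := metric_triangle x y z; have := metric_triangle x z y.
by rewrite (metric_sym z y) ler_norml => ? ?; apply/andP; split; lra.
Qed.

(** Parameters further than [2 * f s0] from [s0] give points further from [x] than [gamma s0], so
    the minimum over a compact piece is global. *)
Lemma geodesic_closest I gamma (x : X) : geodesic I gamma ->
  exists2 t, I t & closest_points (gamma @` I) x (gamma t).
Proof.
move=> [[[s0 Is0] _ cI] gammaE]; pose f t := mdist x (gamma t).
pose K := `[s0 - 2 * f s0, s0 + 2 * f s0] `&` I.
have f0 : 0 <= f s0 by apply: mdist_ge0.
have Ks0 : K s0 by split=> //=; rewrite in_itv /=; apply/andP; split; lra.
have cK : compact K by apply: compact_closedI => //; apply: segment_compact.
have fK : {within K, continuous f}.
  apply/subspace_continuousP => t Kt; apply/cvgrPdist_le => e e0.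
  rewrite near_withinE; near=> s => Ks.
  apply: le_trans (mdist_lip _ _ _) _.
  rewrite gammaE; [|exact: (proj2 Kt)|exact: (proj2 Ks)].
  by near: s; apply: cvgr_dist_le.
have [t /set_mem[_ It] tmin] := compact_EVT_min (ex_intro _ s0 Ks0) cK fK.
exists t => //; split; first by exists t.
move=> _ [s Is <-]; have [Ks|nKs] := pselect (K s); first exact/tmin/mem_set.
apply: le_trans (tmin s0 (mem_set Ks0)) _.
have {}nKs : ~ (s0 - 2 * f s0 <= s <= s0 + 2 * f s0).
  by move=> H; apply: nKs; split=> //=; rewrite in_itv.
have : 2 * f s0 < `|s0 - s|.
  rewrite ltNge ler_norml; apply/negP => /andP[? ?].
  by apply: nKs; apply/andP; split; lra.
rewrite -gammaE //; have := metric_triangle (gamma s0) x (gamma s).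
by rewrite (metric_sym (gamma s0) x) -/(f s0) -/(f s); lra.
Unshelve. all: by end_near.
Qed.

Lemma interval_ge I s0 : is_interval I -> ~ has_ubound I -> I s0 ->
  forall s, s0 <= s -> I s.
Proof.
move=> iI ubI Is0 s s0s; have [u Iu su] : exists2 u, I u & s <= u.
  apply: contrapT => H; apply: ubI; exists s => u Iu.
  by rewrite leNgt; apply/negP => /ltW su; apply: H; exists u.
by apply: (iI s0 u) => //; rewrite s0s.
Qed.

End Geodesics.

(** * Vertices on a geodesic *)

Section GeodesicVertices.
Context {R : realType} {G : groupType} {A : symgenset G}.
Implicit Types (I : set R) (gamma : R -> cay R A).

Lemma bary_pair (p : cay R A) u v : adj A u v -> 0 < p u -> 0 < p v ->
  p u + p v = 1.
Proof.
move=> uv pu pv; apply: on_edgeD; split=> // x px.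
have nuv : u <> v by move=> E; move: uv; rewrite E /adj /= eqxx.
have supp y w z : (forall x, x <> w -> x <> z -> p x = 0) -> 0 < p y ->
    y = w \/ y = z.
  move=> p0 py; have [->|/eqP yw] := eqVneq y w; first by left.
  have [->|/eqP yz] := eqVneq y z; first by right.
  by move: py; rewrite p0 // ltxx.
case: (cay_specP p) => [w _ p0|w z _ _ _ _ p0].
  have S y : 0 < p y -> y = w.
    by move/(supp y w w (fun x xw _ => p0 x xw)) => [].
  by rewrite (S x px) (S u pu); left.
by have := supp _ _ _ p0 px; have := supp _ _ _ p0 pu;
  have := supp _ _ _ p0 pv; intuition congruence.
Qed.

(* The first time at which [gamma] meets an end of the edge of [gamma s0]. *)
Lemma geodesic_vertex I gamma s0 : geodesic I gamma ->
  (forall s, s0 <= s -> I s) -> exists s u, s0 <= s /\ gamma s = vert u.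
Proof.
move=> [_ gammaE] Is.
case: (cay_specP (gamma s0)) => [u pu _|u v uv pu pv puv _].
  by exists s0, u; split=> //; apply: eq_vert.
have lip x s t : s0 <= s -> s0 <= t -> `|gamma s x - gamma t x| <= `|s - t|.
  move=> s0s s0t; rewrite -(gammaE s t); try exact: Is.
  by rewrite mdist_cayE; apply: le_cay_dist => l; apply: path_lengths_ge.
pose Z : set R := [set s | s0 <= s /\ (gamma s u = 0 \/ gamma s v = 0)].
have Zlb : lbound Z s0 by move=> s [].
(* If both [gamma s0] and [gamma (s0 + 2)] had positive coordinate at [u], the path through [u]
   would be shorter than 2. *)
have Z0 : Z !=set0.
  exists (s0 + 2); split; first lra.
  left; apply: bary_eq0 => qu.
  have Is2 : I (s0 + 2) by apply: Is; lra.
  have H : mdist (gamma s0) (gamma (s0 + 2)) = 2.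
    by rewrite gammaE ?ler0_norm //; [lra|lra|exact: Is].
  have : mdist (gamma s0) (gamma (s0 + 2)) <=
      (1 - gamma s0 u) + 0%:R + (1 - gamma (s0 + 2) u).
    by apply: cay_dist_le; right; exists u, u, 0; split=> //; apply: walk0.
  by rewrite H; lra.
pose T := inf Z.
have s0T : s0 <= T by apply: lb_le_inf.
(* Just before [T] both coordinates are positive, so their sum is 1; the Lipschitz bound passes this
   to [T]. *)
have uvT : gamma T u + gamma T v = 1.
  have [E|sT] := eqVneq s0 T; first by rewrite -E.
  apply/eqP; rewrite -subr_eq0 -normr_le0; apply/ler_addgt0Pl => e e0.
  rewrite addr0; pose s := Num.max s0 (T - e / 2).
  have ss0 : s0 <= s by rewrite le_max lexx.
  have sT' : s < T by rewrite gt_max lt_neqAle sT s0T /=; lra.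
  have nZ : ~ Z s by move=> /(ge_inf (ex_intro _ s0 Zlb)); rewrite leNgt sT'.
  have se : `|T - s| <= e / 2.
    by rewrite ger0_norm; [rewrite lerBlDr -lerBlDl le_max lexx orbT|lra].
  have := lip u T s s0T ss0; have := lip v T s s0T ss0.
  have su : 0 < gamma s u.
    by apply: contrapT => /bary_eq0 su; apply: nZ; split=> //; left.
  have sv : 0 < gamma s v.
    by apply: contrapT => /bary_eq0 sv; apply: nZ; split=> //; right.
  have := bary_pair uv su sv.
  rewrite !ler_norml => ? /andP[? ?] /andP[? ?].
  by apply/andP; split; lra.
have T0 : gamma T u = 0 \/ gamma T v = 0.
  apply: contrapT => /not_orP[/eqP Tu /eqP Tv].
  have {}Tu : 0 < gamma T u by rewrite lt_neqAle eq_sym Tu bary_ge0.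
  have {}Tv : 0 < gamma T v by rewrite lt_neqAle eq_sym Tv bary_ge0.
  pose e := Num.min (gamma T u) (gamma T v).
  have e0 : 0 < e by rewrite lt_min Tu.
  have [s [s0s Zs] sTe] : exists2 s, Z s & s < T + e.
    by apply: inf_adherent => //; split=> //; exists s0.
  have Ts : T <= s by apply: ge_inf; [exists s0|split].
  have sTn : `|T - s| < e by rewrite ltr_norml; apply/andP; split; lra.
  have := lip u T s s0T s0s; have := lip v T s s0T s0s.
  have [eu ev] : e <= gamma T u /\ e <= gamma T v by rewrite !ge_min !lexx orbT.
  by case: Zs => ->; rewrite subr0 (ger0_norm (bary_ge0 _ _)); lra.
exists T; case: T0 => E; [exists v|exists u]; split=> //; apply: eq_vert; lra.
Qed.

End GeodesicVertices.

Section FromContractingGeodesic.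
Context {R : realType} {G : groupType} {A : symgenset G}.
Notation d := (wdist A).
Implicit Types (I : set R) (gamma : R -> cay R A).

Lemma strongly_contracting_of_geodesic I gamma :
  geodesic I gamma -> ~ has_ubound I -> contracting (gamma @` I) ->
  exists g C N, strongly_contracting (A := A) g C N.
Proof.
move=> gI ubI [D gammaD]; have [[[s0 Is0] iI cI] gammaE] := gI.
have [T [u [s0T gT]]] := geodesic_vertex gI (interval_ge iI ubI Is0).
have IT : I T by apply: interval_ge s0T.
have /choice[g gE] : forall n : int, exists v,
    I (T + n%:~R) -> gamma (T + n%:~R) = vert v.
  move=> n; have [In|nI] := pselect (I (T + n%:~R)); last by exists 1%g.
  have [v vE] : exists v, gamma (T + n%:~R) = vert v.
    apply: (@vert_int_dist _ _ _ u _ `|n|%N).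
    by rewrite -gT gammaE // opprD addNKr normrN -intr_norm -abszE.
  by exists v.
pose J n := I (T + n%:~R).
pose P x i := J i /\ exists t,
  [/\ I t, closest_points (gamma @` I) (vert x) (gamma t)
    & `|t - (T + i%:~R)| <= 1].
have dE x i : J i -> (d x (g i))%:R = mdist (vert x) (gamma (T + i%:~R)).
  by move=> Ji; rewrite gE // mdist_vert.
(* The 2 pays for rounding the parameters of two closest points. *)
pose M := `|Num.ceil (D + 2)|%N.
have DM : D + 2 <= M%:R.
  apply: le_trans (ceil_ge _) _; rewrite -[M%:R]/(M%:~R) /M abszE intr_norm.
  exact: ler_norm.
have gJ i j : J i -> J j -> d (g i) (g j) = `|i - j|%N.
  move=> Ji Jj; apply/eqP; rewrite -(eqr_nat R) dE // -gE // gammaE //.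
  by rewrite opprD addrACA subrr add0r -intrB -intr_norm -abszE.
have Pex x : exists i, P x i.
  have [t It tx] := geodesic_closest (vert x) gI.
  (* Rounding goes towards [T], so that the rounded parameter stays in [I]. *)
  have [tT|Tt] := leP t T.
    have /andP[c1 c2] := ceil_itv (t - T); rewrite intrB in c1.
    exists (Num.ceil (t - T)); split.
      have c0 : (Num.ceil (t - T))%:~R <= 0 :> R by rewrite lerz0 ceil_le0; lra.
      by apply: (iI t T) => //; apply/andP; split; lra.
    by exists t; split=> //; rewrite ler_norml; apply/andP; split; lra.
  have /andP[f1 f2] := floor_itv (t - T); rewrite intrD in f2.
  exists (Num.floor (t - T)); split.
    have f0 : 0 <= (Num.floor (t - T))%:~R :> R by rewrite ler0z floor_ge0; lra.
    by apply: (iI T t) => //; apply/andP; split; lra.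
  by exists t; split=> //; rewrite ler_norml; apply/andP; split; lra.
have near x i t : J i -> I t -> `|t - (T + i%:~R)| <= 1 ->
    `|mdist (vert x) (gamma t) - (d x (g i))%:R| <= 1.
  move=> Ji It ti; rewrite dE //; apply: le_trans (mdist_lip _ _ _) _.
  by rewrite gammaE.
have Pmin x i j : P x i -> J j -> (d x (g i) <= d x (g j) + 1)%N.
  move=> [Ji [t [It [_ tx] ti]]] Jj; rewrite -(ler_nat R) natrD (dE _ _ Jj).
  have {}tx : mdist (vert x) (gamma t) <= mdist (vert x) (gamma (T + j%:~R)).
    by apply: tx; exists (T + j%:~R).
  by have := near x i t Ji It ti; rewrite ler_norml => /andP[? ?]; lra.
have Pball x y i j : P x i -> P y j -> (d x y + 1 < d x (g i))%N ->
    (`|i - j| <= M)%N.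
  move=> [Ji [t [It tx ti]]] [Jj [s [Is sy sj]]].
  rewrite -(ltr_nat R) natrD => xy.
  (* Rounding costs at most 1, so the geodesic is still at distance more than [d x y] from
     [vert x]. *)
  have ball0 : closed_mball (vert x) (d x y)%:R `&` (gamma @` I) = set0.
    rewrite -subset0 => p [xp pI]; have := proj2 tx p pI.
    have := near x i t Ji It ti; rewrite ler_norml => /andP[? ?].
    by move: xp; rewrite /closed_mball /=; lra.
  have /ereal_supP H := gammaD _ _ ball0.
  have {H} : mdist (gamma t) (gamma s) <= D.
    rewrite -lee_fin; apply: H; right; exists (gamma t).
      by exists (vert x) => //; rewrite /closed_mball /= mdistxx ler0n.
    exists (gamma s) => //; exists (vert y) => //.
    by rewrite /closed_mball /= mdist_vert.
  rewrite gammaE // -(ler_nat R) pmulrn abszE intr_norm intrB.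
  move: ti sj; rewrite !ler_norml => /andP[? ?] /andP[? ?] /andP[? ?].
  by apply/andP; split; lra.
have := strongly_contracting_of_balls gJ (fun x i => @proj1 _ _) Pex Pmin Pball.
move=> H; have gN := H (fun n : nat => interval_ge iI ubI IT _).
do 3!eexists; apply: gN => n.
by rewrite lerDl ler0z.
Qed.

End FromContractingGeodesic.

Section ActionLaws.
Context {R : realType} {G : groupType} {A : symgenset G}.

Lemma cay_act1 (p : cay R A) : cay_act 1%g p = p.
Proof. by apply: val_inj; apply/funext => x /=; rewrite invg1 mul1g. Qed.

Lemma cay_actM (g h : G) (p : cay R A) :
  cay_act (g * h)%g p = cay_act g (cay_act h p).
Proof. by apply: val_inj; apply/funext => x /=; rewrite invgM mulgA. Qed.

End ActionLaws.

Theorem corollary1p3 (R : realType) (G : groupType) (A : symgenset G) :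
  (has_infinite_contracting_geodesic (cay R A) ->
     exists g : G, contracting_isometry R A g) /\
  (torsion G -> ~ has_infinite_contracting_geodesic (cay R A)).
Proof.
have isom : has_infinite_contracting_geodesic (cay R A) ->
    exists g : G, contracting_isometry R A g.
  move=> [I [gamma [gI unbounded gammaC]]].
  suff [g [C [N gN]]] : exists g C N, strongly_contracting (A := A) g C N.
    exact: strongly_contracting_isometry gN.
  have [ubI|] := pselect (has_ubound I); last first.
    by move=> ubI; apply: strongly_contracting_of_geodesic gI ubI gammaC.
  have lbI : ~ has_lbound I by move=> lbI; apply: unbounded.
  have [[[s0 Is0] iI cI] gammaE] := gI.
  (* The interval is unbounded below, so the geodesic is reversed. *)
  apply: (@strongly_contracting_of_geodesic _ _ _ (-%R @` I) (gamma \o -%R)).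
  - split; last first.
      move=> _ _ [s Is <-] [t It <-] /=.
      by rewrite !opprK gammaE // -normrN; congr `|_|; lra.
    split; first by exists (- s0), s0.
      move=> _ _ [s Is <-] [t It <-] z /andP[sz zt].
      exists (- z); last exact: opprK.
      by apply: (iI t s) => //; apply/andP; split; lra.
    exact: closedN.
  - by move/has_lb_ubN.
  - rewrite image_comp (_ : _ \o _ = gamma) //.
    by apply/funext => s /=; rewrite opprK.
split=> // torG /isom[g [gamma [[_ gammaE] _ _ [tau tau0 act]]]].
have [n [n0 gn]] := torG g.
(* [g ^+ n = 1] fixes [gamma 0], but also moves it by [tau *+ n], which is nonzero. *)
have actn k t : cay_act (g ^+ k)%g (gamma t) = gamma (t + tau *+ k).
  elim: k t => [|k IH] t; first by rewrite cay_act1 addr0.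
  rewrite expgS cay_actM IH act; congr gamma; rewrite mulrSr; lra.
have := actn n 0; rewrite gn add0r.
rewrite cay_act1.
move=> E; have := gammaE 0 (tau *+ n) I I; rewrite -E mdistxx sub0r normrN.
by move/esym/eqP; rewrite normr_eq0 mulrn_eq0 (negbTE tau0); case: n n0 {gn E}.
Qed.
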